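(* Let $G$ be a graph and let $v,w$ be two distinct vertices of $G$ such that $H=G\setminus\{v,w\}$ is an anchor of $G$. If the shadow $s_{v,H}$ is fixed on $H$ (or the shadow $s_{w,H}$ is fixed on $H$), then $G$ is reconstructible.
   Context: All graphs are finite and simple. For $X\subseteq V(G)$, $G\setminus X$ denotes the induced subgraph of $G$ on $V(G)-X$. An anchor of $G$ is a nonempty proper induced subgraph $H$ of $G$ that occurs exactly once in $G$, i.e. no other subset of $V(G)$ induces a subgraph isomorphic to $H$. A shadow on a graph $H$ is a subset of $V(H)$. For an induced subgraph $H$ of $G$ and $v\in V(G)-V(H)$, the shadow of $v$ on $H$ is $s_{v,H}=N(v)\cap V(H)$, where $N(v)$ is the set of neighbors of $v$ in $G$. A shadow $s$ on $H$ is fixed on $H$ if $\theta(s)=s$ (as sets) for every $\theta\in\mathrm{Aut}(H)$. The deck of $G$ is the multiset of isomorphism types of the graphs $G\setminus\{x\}$, $x\in V(G)$. $G$ is reconstructible if every graph with the same deck as $G$ is isomorphic to $G$. *)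

(* Defs.v *)
From HB Require Import structures.
From mathcomp Require Import all_boot all_fingroup.

Set Implicit Arguments.
Unset Strict Implicit.
Unset Printing Implicit Defensive.

Record sgraph := SGraph {
  vertex :> finType;
  adj : rel vertex;
  adj_sym : symmetric adj;
  adj_irrefl : irreflexive adj }.

Definition isomorphism (G K : sgraph) (f : G -> K) : Prop :=
  bijective f /\ forall x y : G, adj (f x) (f y) = adj x y.

Definition isomorphic (G K : sgraph) : Prop :=
  exists f : G -> K, isomorphism f.

(* Boolean counterpart of [isomorphic], so that isomorphic copies can be
   counted with #|_|. *)
Definition isomorphicb (G K : sgraph) : bool :=
  [exists f : {ffun G -> K},
    [&& injectiveb f, #|K| <= #|G| &
        [forall x, forall y, adj (f x) (f y) == adj x y]]].

Lemma isomorphicP (G K : sgraph) : reflect (isomorphic G K) (isomorphicb G K).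
Proof.
apply: (iffP existsP) => [[f /and3P[/injectiveP f_inj leKG /forallP f_adj]]|].
  exists f; split; first exact: inj_card_bij.
  by move=> x y; apply/eqP; have /forallP := f_adj x; apply.
case=> f [f_bij f_adj]; exists (finfun f); apply/and3P; split.
- by apply/injectiveP => x y; rewrite !ffunE; apply: (bij_inj f_bij).
- by rewrite (bij_eq_card f_bij).
- by apply/forallP => x; apply/forallP => y; rewrite !ffunE f_adj.
Qed.

Section Induced.
Variables (G : sgraph) (S : {set G}).

Definition induced_adj : rel {x : G | x \in S} :=
  fun x y => adj (val x) (val y).

Lemma induced_adj_sym : symmetric induced_adj.
Proof. by move=> x y; apply: adj_sym. Qed.

Lemma induced_adj_irrefl : irreflexive induced_adj.
Proof. by move=> x; apply: adj_irrefl. Qed.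

Definition induced : sgraph := SGraph induced_adj_sym induced_adj_irrefl.
End Induced.

(* An induced subgraph of G is represented by its vertex set. *)
Definition anchor (G : sgraph) (S : {set G}) : Prop :=
  [/\ S != set0, S \proper [set: G] &
      forall S' : {set G}, isomorphic (induced S') (induced S) -> S' = S].

Definition automorphisms (H : sgraph) : {set {perm H}} :=
  [set p : {perm H} | [forall x, forall y, adj (p x) (p y) == adj x y]].

Definition shadow (G : sgraph) (v : G) (S : {set G}) : {set induced S} :=
  [set u : induced S | adj v (val u)].

Definition fixed_shadow (H : sgraph) (s : {set H}) : Prop :=
  forall p : {perm H}, p \in automorphisms H -> p @: s = s.

(* The deck, a multiset of isomorphism types, is given by its multiplicity
   function: [deck G K] is the multiplicity of the isomorphism type of K. *)
Definition deck (G K : sgraph) : nat :=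
  #|[set x : G | isomorphicb (induced (~: [set x])) K]|.

Definition same_deck (G G' : sgraph) : Prop :=
  forall K : sgraph, deck G K = deck G' K.

Definition reconstructible (G : sgraph) : Prop :=
  forall G' : sgraph, same_deck G' G -> isomorphic G' G.

(* Main.v *)
Require Import Defs.
From mathcomp Require Import all_boot all_fingroup.

Set Implicit Arguments.
Unset Strict Implicit.
Unset Printing Implicit Defensive.

(** Let L have the same deck as G.  Counting pairs (x, S) where S induces a copy
    of K and x lies off S shows that the cards determine the number of copies
    of every graph K with fewer vertices than G (Kelly's lemma,
    [same_deck_copies]).  Hence L also has exactly one copy H' of the anchor H,
    and H' misses exactly two vertices.  The cards of L isomorphic to G - v and
    G - w contain a copy of H, which must be H', so they arise by deleting the
    two vertices v', w' off H'; isomorphisms f : G - v -> L - v' and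
    g : G - w -> L - w' exist, and by uniqueness both map H onto H'.  Hence f
    maps w to w', g maps v to v'.

    On H, f and g differ by an automorphism of H.  If the shadow of v is fixed,
    f and g have the same effect on it, and since g carries it to the shadow of
    v', so does f.  Extending f by v |-> v' therefore gives an isomorphism
    G -> L, as soon as v' and w' are adjacent exactly when v and w are
    ([isomorphic_glue]).  That last point is again a count: the copies of the
    two-vertex graph G[v, w] through both v and w are determined by the numbers
    of copies in G, G - v, G - w and H, all of which agree with those in L
    ([same_deck_adj]).  If it is the shadow of w that is fixed, exchange the
    roles of v and w. *)

(** * Isomorphisms and partial embeddings *)

Lemma isomorphic_refl (G : sgraph) : isomorphic G G.
Proof. by exists id; split=> //; exists id. Qed.

Lemma isomorphic_sym (G K : sgraph) : isomorphic G K -> isomorphic K G.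
Proof.
case=> f [[g fK gK] f_adj]; exists g; split; first by exists f.
by move=> x y; rewrite -f_adj !gK.
Qed.

Lemma isomorphic_trans (G K L : sgraph) :
  isomorphic G K -> isomorphic K L -> isomorphic G L.
Proof.
case=> f [f_bij f_adj] [g [g_bij g_adj]]; exists (g \o f).
by split=> [|x y /=]; [apply: bij_comp | rewrite g_adj f_adj].
Qed.

Lemma isomorphic_card (G K : sgraph) : isomorphic G K -> #|G| = #|K|.
Proof. by case=> f [f_bij _]; apply: bij_eq_card f_bij. Qed.

Lemma card_induced (G : sgraph) (S : {set G}) : #|induced S| = #|S|.
Proof. by rewrite card_sig; apply: eq_card. Qed.

(** Maps between whole vertex types, constrained only on S, can be restricted
    and extended without moving between the subtypes carrying the induced
    subgraphs. *)
Definition embedding_on (G K : sgraph) (f : G -> K) (S : {set G}) : Prop :=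
  {in S &, injective f} /\ {in S &, forall x y, adj (f x) (f y) = adj x y}.

Lemma embedding_onS (G K : sgraph) (f : G -> K) (S T : {set G}) :
  S \subset T -> embedding_on f T -> embedding_on f S.
Proof.
move=> /subsetP sST [f_inj f_adj].
by split=> x y /sST Tx /sST Ty; [apply: f_inj | apply: f_adj].
Qed.

Lemma embedding_restrict (G K : sgraph) (f : G -> K) (S : {set G}) (T : {set K}) :
  embedding_on f S -> f @: S = T ->
  exists2 phi : induced S -> induced T,
    isomorphism phi & forall u, val (phi u) = f (val u).
Proof.
move=> [f_inj f_adj] <-.
pose phi (u : induced S) : induced (f @: S) :=
  exist _ (f (val u)) (imset_f f (valP u)).
exists phi => //; split=> [|x y]; last exact: f_adj (valP x) (valP y).
apply: inj_card_bij => [x y /(congr1 val) /= eq_f|].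
  by apply: val_inj; apply: f_inj eq_f; apply: valP.
by rewrite !card_induced card_in_imset.
Qed.

Lemma isomorphic_imset (G K : sgraph) (f : G -> K) (S : {set G}) :
  embedding_on f S -> isomorphic (induced S) (induced (f @: S)).
Proof. by case/embedding_restrict/(_ erefl)=> phi phi_iso _; exists phi. Qed.

(** The argument of type K only supplies the value of the map outside S. *)
Lemma isomorphic_induced_embedding (G K : sgraph) (S : {set G}) (T : {set K}) :
  K -> isomorphic (induced S) (induced T) ->
  exists2 f : G -> K, embedding_on f S & f @: S = T.
Proof.
move=> y0 [phi [[psi phiK psiK] phi_adj]].
pose f x := if insub x is Some u then val (phi u) else y0.
have fE (u : induced S) : f (val u) = val (phi u) by rewrite /f valK.
have f_in x (Sx : x \in S) : f x = val (phi (exist _ x Sx)).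
  exact: (fE (exist _ x Sx)).
exists f.
  split=> x y Sx Sy; rewrite !(f_in _ Sx, f_in _ Sy).
    by move/val_inj/(can_inj phiK)/(congr1 val).
  exact: phi_adj.
apply/setP=> y; apply/imsetP/idP=> [[x Sx ->]|Ty].
  by rewrite (f_in _ Sx); apply: valP.
by exists (val (psi (exist _ y Ty))); [apply: valP | rewrite fE psiK].
Qed.

(** * Counting copies in the deck *)

Definition copies (K G : sgraph) : {set {set G}} :=
  [set S : {set G} | isomorphicb (induced S) K].

Lemma copiesP (K G : sgraph) (S : {set G}) :
  reflect (isomorphic (induced S) K) (S \in copies K G).
Proof. by rewrite inE; apply: isomorphicP. Qed.

Lemma card_copy (K G : sgraph) (S : {set G}) : S \in copies K G -> #|S| = #|K|.
Proof. by move/copiesP/isomorphic_card; rewrite card_induced. Qed.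

Lemma imset_copy (K G L : sgraph) (f : G -> L) (S : {set G}) :
  embedding_on f S -> (f @: S \in copies K L) = (S \in copies K G).
Proof.
move/isomorphic_imset=> isoS; apply/copiesP/copiesP; apply: isomorphic_trans => //.
exact: isomorphic_sym.
Qed.

(** Used for the inclusion of an induced subgraph and for an isomorphism: the
    first turns copies in a card into copies in the graph, the second makes
    the number of copies an invariant. *)
Lemma card_copies_embedding (K G L : sgraph) (f : G -> L) :
  embedding_on f [set: G] ->
  #|copies K G| = #|[set S in copies K L | S \subset f @: [set: G]]|.
Proof.
move=> f_emb; have f_embS S : embedding_on f S by apply: embedding_onS f_emb.
have f_inj : injective f by move=> x y; apply: f_emb.1; rewrite inE.
rewrite -(card_imset _ (imset_inj f_inj)); apply: eq_card => T.
rewrite [RHS]inE; apply/imsetP/andP=> [[S copyS ->]|[copyT sT]].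
  by rewrite imset_copy //; split=> //; apply: imsetS.
have defT : T = f @: (f @^-1: T).
  apply/setP=> y; apply/idP/imsetP=> [Ty|[x + ->]]; last by rewrite inE.
  by have /imsetP[x _ def_y] := subsetP sT y Ty; exists x; rewrite // inE -def_y.
by exists (f @^-1: T) => //; rewrite -(imset_copy _ (f_embS _)) -defT.
Qed.

Lemma card_copies_induced (K G : sgraph) (A : {set G}) :
  #|copies K (induced A)| = #|[set S in copies K G | S \subset A]|.
Proof.
rewrite (@card_copies_embedding _ (induced A) G (fun u => val u)); last first.
  by split=> // x y _ _; apply: val_inj.
suff -> : (fun u : induced A => val u) @: [set: induced A] = A by [].
apply/setP=> x; apply/imsetP/idP=> [[u _ ->]|Ax]; first exact: valP.
by exists (exist _ x Ax).
Qed.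

Lemma card_copies_isomorphic (K G L : sgraph) :
  isomorphic G L -> #|copies K G| = #|copies K L|.
Proof.
case=> f [f_bij f_adj]; rewrite (@card_copies_embedding _ _ _ f).
  apply: eq_card => S; rewrite inE; case: (S \in _) => //=.
  suff -> : f @: [set: G] = [set: L] by rewrite subsetT.
  case: f_bij => g _ gK; apply/setP=> y; rewrite inE -[y]gK.
  exact: imset_f.
by split=> // x y _ _; apply: (bij_inj f_bij).
Qed.

(** The deck only records multiplicities of isomorphism types, so the two sums
    are compared after grouping the vertices of both graphs by the isomorphism
    type of their card. *)
Lemma same_deck_sum (F : sgraph -> nat) (G L : sgraph) :
  (forall A B, isomorphic A B -> F A = F B) -> same_deck G L ->
  \sum_(x : G) F (induced (~: [set x])) = \sum_(x : L) F (induced (~: [set x])).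
Proof.
move=> F_iso eq_deck.
pose C (t : G + L) :=
  match t with inl x => induced (~: [set x]) | inr x => induced (~: [set x]) end.
(* [r t] represents the class of t: the choice made by [pick] depends only on
   the predicate it is given, hence only on the isomorphism type of [C t]. *)
pose r t := odflt t [pick s | isomorphicb (C t) (C s)].
have isoC_r t : isomorphic (C t) (C (r t)).
  rewrite /r; case: pickP => [s /isomorphicP //|_]; exact: isomorphic_refl.
have r_iso s t : isomorphic (C s) (C t) -> r s = r t.
  move=> iso_st; rewrite /r (@eq_pick _ _ (fun u => isomorphicb (C t) (C u))).
    case: pickP => // /(_ t) /isomorphicP; case; exact: isomorphic_refl.
  move=> u; apply/isomorphicP/isomorphicP; apply: isomorphic_trans => //.
  exact: isomorphic_sym.
have r_eq s t : (r s == t) = (r t == t) && isomorphicb (C s) (C t).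
  apply/eqP/andP=> [<-|[/eqP rt /isomorphicP iso_st]]; last by rewrite (r_iso _ _ iso_st).
  by split; [apply/eqP/esym/r_iso | apply/isomorphicP].
have sum_classes (X : sgraph) (i : X -> G + L) :
    (forall x, C (i x) = induced (~: [set x])) ->
    \sum_(x : X) F (induced (~: [set x])) =
    \sum_(t | r t == t) deck X (C t) * F (C t).
  move=> Ci; rewrite (partition_big (r \o i) (fun t => r t == t)) /=; last first.
    by move=> x _; apply/eqP/esym/r_iso.
  apply: eq_bigr => t rt; rewrite -sum_nat_const; apply: eq_big => x.
    by rewrite inE r_eq rt Ci.
  rewrite r_eq Ci => /andP[_ /isomorphicP]; exact: F_iso.
rewrite (sum_classes G inl) // (sum_classes L inr) //.
by apply: eq_bigr => t _; rewrite eq_deck.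
Qed.

Lemma same_deck_card (G L : sgraph) : same_deck G L -> #|G| = #|L|.
Proof. by move/(@same_deck_sum (fun=> 1)); rewrite !sum1_card; apply. Qed.

(** A card determines a deleted vertex only up to the multiplicity of its
    isomorphism type: when the two chosen cards are isomorphic, the two
    deleted vertices must be found inside a single class of multiplicity at
    least two, and otherwise they come from different classes. *)
Lemma same_deck_two_cards (G L : sgraph) (v w : G) :
  v != w -> same_deck L G ->
  exists v' w' : L,
    [/\ v' != w',
        isomorphic (induced (~: [set v'])) (induced (~: [set v])) &
        isomorphic (induced (~: [set w'])) (induced (~: [set w]))].
Proof.
move=> neq eq_deck.
pose D (x : G) := [set y : L | isomorphicb (induced (~: [set y])) (induced (~: [set x]))].
have cardD x : #|D x| = deck G (induced (~: [set x])) by apply: eq_deck.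
have D_gt0 x : 0 < #|D x|.
  rewrite cardD; apply/card_gt0P; exists x; rewrite inE.
  by apply/isomorphicP/isomorphic_refl.
have [v' [w' [Dv Dw neq']]] : exists v' w' : L, [/\ v' \in D v, w' \in D w & v' != w'].
  have [/isomorphicP iso_vw|not_iso] :=
    boolP (isomorphicb (induced (~: [set v])) (induced (~: [set w]))).
    have /card_gt1P[v' [w' [Dv Dw neq']]] : 1 < #|D v|.
      rewrite cardD; apply/card_gt1P; exists v, w; rewrite !inE.
      split=> //; apply/isomorphicP; first exact: isomorphic_refl.
      exact: isomorphic_sym.
    exists v', w'; split=> //; rewrite inE; apply/isomorphicP.
    by apply: isomorphic_trans iso_vw; apply/isomorphicP; rewrite inE in Dw.
  have /card_gt0P[v' Dv] := D_gt0 v; have /card_gt0P[w' Dw] := D_gt0 w.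
  exists v', w'; split=> //; apply: contraNneq not_iso => eq_v'w'.
  rewrite eq_v'w' inE in Dv; rewrite inE in Dw.
  apply/isomorphicP; apply: isomorphic_trans (isomorphicP _ _ Dw).
  exact/isomorphic_sym/isomorphicP.
by exists v', w'; split=> //; apply/isomorphicP; [rewrite inE in Dv | rewrite inE in Dw].
Qed.

(** Double counting: a copy S survives in the card G - x exactly when x is one
    of the #|G| - #|K| vertices off S. *)
Lemma sum_copies_cards (K G : sgraph) :
  \sum_(x : G) #|copies K (induced (~: [set x]))| =
  #|copies K G| * (#|G| - #|K|).
Proof.
transitivity (\sum_(x : G) \sum_(S in copies K G | x \notin S) 1).
  apply: eq_bigr => x _; rewrite card_copies_induced -sum1_card.
  by apply: eq_bigl => S; rewrite !inE subsetC sub1set inE.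
rewrite (exchange_big_dep (mem (copies K G))) /=; last by move=> x S _ /andP[].
rewrite -sum_nat_const; apply: eq_bigr => S copyS.
rewrite -(card_copy copyS) -(cardsC S) addKn -sum1_card; apply: eq_bigl => x.
by rewrite [RHS]inE copyS.
Qed.

(** Kelly's lemma. *)
Lemma same_deck_copies (K G L : sgraph) :
  same_deck G L -> #|K| < #|L| -> #|copies K G| = #|copies K L|.
Proof.
move=> eq_deck ltKL; apply/eqP.
rewrite -(@eqn_pmul2r (#|L| - #|K|)) ?subn_gt0 // -{1}(same_deck_card eq_deck).
rewrite -!sum_copies_cards; apply/eqP.
apply: (same_deck_sum (F := fun A => #|copies K A|)) eq_deck => A B.
exact: card_copies_isomorphic.
Qed.

(** Inclusion-exclusion: each side counts a copy avoiding both v and w twice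
    and every other copy once.  The copies through both vertices are thereby
    determined by four counts in induced subgraphs. *)
Lemma card_copies_pair (K G : sgraph) (v w : G) :
  #|[set S in copies K G | [set v; w] \subset S]| +
  (#|copies K (induced (~: [set v]))| + #|copies K (induced (~: [set w]))|) =
  #|copies K G| + #|copies K (induced (~: [set v; w]))|.
Proof.
have card_sum (A : {set {set G}}) : #|A| = \sum_S (S \in A).
  by rewrite -sum1_card big_mkcond; apply: eq_bigr => S _; case: (S \in A).
rewrite !card_copies_induced !card_sum -!big_split; apply: eq_bigr => S _ /=.
rewrite !inE subUset !sub1set ![S \subset ~: _]subsetC !subUset !sub1set !inE.
by case: (isomorphicb _ _); case: (v \in S); case: (w \in S).
Qed.

(** * Gluing two cards along a fixed shadow *)

(** g^-1 f is an automorphism of H, so it maps s to itself. *)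
Lemma fixed_shadow_imset (H K : sgraph) (s : {set H}) (f g : H -> K) :
  fixed_shadow s -> isomorphism f -> isomorphism g -> f @: s = g @: s.
Proof.
move=> s_fixed [f_bij f_adj] [[h gK hK] g_adj].
have p_inj : injective (h \o f) by apply: inj_comp (can_inj hK) (bij_inj f_bij).
have eq_s : perm p_inj @: s = s.
  apply: s_fixed; rewrite inE; apply/forallP=> x; apply/forallP=> y.
  by rewrite !permE -g_adj /= !hK f_adj.
rewrite -[in RHS]eq_s -imset_comp; apply: eq_imset => x /=.
by rewrite permE /= hK.
Qed.

Lemma fixed_shadow_embeddings (G L : sgraph) (S : {set G}) (T : {set L})
    (s : {set induced S}) (f g : G -> L) :
  fixed_shadow s ->
  embedding_on f S -> f @: S = T -> embedding_on g S -> g @: S = T ->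
  f @: (val @: s) = g @: (val @: s).
Proof.
move=> s_fixed f_emb fS g_emb gS.
have [phi phi_iso phiE] := embedding_restrict f_emb fS.
have [psi psi_iso psiE] := embedding_restrict g_emb gS.
rewrite -!imset_comp -(eq_imset s phiE) -(eq_imset s psiE).
by rewrite !(imset_comp val) (fixed_shadow_imset s_fixed phi_iso psi_iso).
Qed.

(** w' has a preimage off v, and it cannot lie in G - {v, w}. *)
Lemma embedding_deleted_vertex (G L : sgraph) (f : G -> L) (v w : G) (v' w' : L) :
  v' != w' -> f @: (~: [set v]) = ~: [set v'] ->
  f @: (~: [set v; w]) = ~: [set v'; w'] -> f w = w'.
Proof.
move=> neq' fv fvw.
have /imsetP[x] : w' \in f @: (~: [set v]) by rewrite fv !inE eq_sym.
rewrite !inE => xv w'E; have [<- //|xw] := eqVneq x w.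
have : f x \in f @: (~: [set v; w]) by rewrite imset_f // !inE negb_or xv.
by rewrite fvw !inE -w'E eqxx orbT.
Qed.

(** The map sends v to v' and agrees with f elsewhere.  Only g sees the vertex
    v, and only f sees w; the fixed shadow transfers to f what g says about the
    neighbours of v. *)
Lemma isomorphic_glue (G L : sgraph) (v w : G) (v' w' : L) (f g : G -> L) :
  v != w -> v' != w' -> #|G| = #|L| -> adj v' w' = adj v w ->
  embedding_on f (~: [set v]) -> f @: (~: [set v]) = ~: [set v'] ->
  embedding_on g (~: [set w]) -> g @: (~: [set w]) = ~: [set w'] ->
  f @: (~: [set v; w]) = ~: [set v'; w'] ->
  g @: (~: [set v; w]) = ~: [set v'; w'] ->
  fixed_shadow (shadow v (~: [set v; w])) ->
  isomorphic G L.
Proof.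
move=> neq neq' eq_card adj_vw f_emb fv g_emb gw fvw gvw s_fixed.
have fw : f w = w' by apply: embedding_deleted_vertex fv fvw.
have gv : g v = v'.
  by apply: (embedding_deleted_vertex (v := w) (v' := w'));
     rewrite ?(setUC [set w]) ?(setUC [set w']) // eq_sym.
have f_embH : embedding_on f (~: [set v; w]).
  by apply: embedding_onS f_emb; rewrite setCS subsetUl.
have g_embH : embedding_on g (~: [set v; w]).
  by apply: embedding_onS g_emb; rewrite setCS subsetUr.
have := fixed_shadow_embeddings s_fixed f_embH fvw g_embH gvw.
have -> : val @: shadow v (~: [set v; w]) = [set u in ~: [set v; w] | adj v u].
  apply/setP=> u; apply/imsetP/idP=> [[z + ->]|].
    by rewrite [_ \in shadow _ _]inE => vz; rewrite inE vz andbT; apply: (valP z).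
  by rewrite inE => /andP[Hu vu]; exists (exist _ u Hu); rewrite // inE.
set N := [set u in _ | _] => eq_fN_gN.
have adj_g u : u \in ~: [set v; w] -> adj v' (g u) = adj v u.
  rewrite !inE negb_or => /andP[_ uw].
  by rewrite -gv g_emb.2 // !inE.
have adj_f u : u \in ~: [set v; w] -> adj v' (f u) = adj v u.
  move=> Hu; apply/idP/idP=> adj_u.
    have /imsetP[y Hy fu] : f u \in g @: (~: [set v; w]) by rewrite gvw -fvw imset_f.
    have : f u \in f @: N.
      by rewrite eq_fN_gN fu imset_f // inE Hy -adj_g // -fu.
    case/imsetP=> z; rewrite inE => /andP[Hz vz].
    by move/(f_embH.1 _ _ Hu Hz) ->.
  have /imsetP[y + ->] : f u \in g @: N by rewrite -eq_fN_gN imset_f // inE Hu.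
  by rewrite inE => /andP[Hy vy]; rewrite adj_g.
have adj_fv u : u != v -> adj v' (f u) = adj v u.
  move=> uv; have [->|uw] := eqVneq u w; first by rewrite fw.
  by apply: adj_f; rewrite !inE negb_or uv.
have f_neq u : u != v -> f u != v'.
  move=> uv; have : f u \in f @: (~: [set v]) by rewrite imset_f // !inE.
  by rewrite fv !inE.
exists (fun x => if x == v then v' else f x); split.
  apply: inj_card_bij => [x y|]; last by rewrite eq_card.
  have [->|xv] := eqVneq x v; have [->|yv] := eqVneq y v => //.
  - by move/esym/eqP; rewrite (negPf (f_neq _ yv)).
  - by move/eqP; rewrite (negPf (f_neq _ xv)).
  - by apply: f_emb.1; rewrite !inE.
move=> x y; have [->|xv] := eqVneq x v; have [->|yv] := eqVneq y v.
- by rewrite !adj_irrefl.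
- exact: adj_fv.
- by rewrite adj_sym adj_fv // adj_sym.
- by rewrite f_emb.2 // !inE.
Qed.

(** * Adjacency of the two missing vertices *)

Lemma isomorphic_pair_adj (G L : sgraph) (v w : G) (v' w' : L) :
  v != w -> isomorphic (induced [set v; w]) (induced [set v'; w']) ->
  adj v w = adj v' w'.
Proof.
move=> neq /(isomorphic_induced_embedding v')[f [f_inj f_adj] fvw].
have [v_in w_in] := (set21 v w, set22 v w).
rewrite -(f_adj _ _ v_in w_in).
have := imset_f f v_in; have := imset_f f w_in; rewrite fvw !inE.
have neq_f : f v != f w by apply: contraNneq neq => /(f_inj _ _ v_in w_in)/eqP.
case/orP=> /eqP fw; case/orP=> /eqP fv; move: neq_f; rewrite fv fw ?eqxx //.
by rewrite adj_sym.
Qed.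

(** Counts copies of the two-vertex graph K = G[v, w]: the only set of two
    vertices containing both v and w is {v, w} itself, so a copy of K through
    v' and w' says that L[v', w'] is isomorphic to K.  The bound 2 < #|G| is
    what Kelly's lemma requires of K. *)
Lemma same_deck_adj (G L : sgraph) (v w : G) (v' w' : L) :
  v != w -> v' != w' -> 2 < #|G| -> same_deck L G ->
  isomorphic (induced (~: [set v'])) (induced (~: [set v])) ->
  isomorphic (induced (~: [set w'])) (induced (~: [set w])) ->
  isomorphic (induced (~: [set v'; w'])) (induced (~: [set v; w])) ->
  adj v' w' = adj v w.
Proof.
move=> neq neq' ltG eq_deck iso_v iso_w iso_vw.
pose K := induced [set v; w]; have cardK : #|K| = 2 by rewrite card_induced cards2 neq.
have eq_pairs : #|[set S in copies K L | [set v'; w'] \subset S]| =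
                #|[set S in copies K G | [set v; w] \subset S]|.
  apply/eqP.
  rewrite -(eqn_add2r (#|copies K (induced (~: [set v]))| +
                       #|copies K (induced (~: [set w]))|)).
  rewrite -{1}(card_copies_isomorphic _ iso_v) -{1}(card_copies_isomorphic _ iso_w).
  rewrite !card_copies_pair (card_copies_isomorphic _ iso_vw).
  by rewrite (same_deck_copies eq_deck) ?cardK.
have /card_gt0P[S] : 0 < #|[set S in copies K L | [set v'; w'] \subset S]|.
  rewrite eq_pairs; apply/card_gt0P; exists [set v; w].
  by rewrite !inE subxx andbT; apply/isomorphicP/isomorphic_refl.
rewrite inE => /andP[copyS sS]; apply: isomorphic_pair_adj => //.
suff -> : [set v'; w'] = S by apply/copiesP.
by apply/eqP; rewrite eqEcard sS (card_copy copyS) cardK cards2 neq'.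
Qed.

(** * Reconstruction *)

Theorem theorem1 (G : sgraph) (v w : G) (hvw : v <> w)
  (hanchor : anchor (~: [set v; w]))
  (hfixed : fixed_shadow (shadow v (~: [set v; w])) \/
            fixed_shadow (shadow w (~: [set v; w]))) :
  reconstructible G.
Proof.
move=> L eq_deck; apply: isomorphic_sym.
have [H_neq0 _ H_uniq] := hanchor; have /eqP neq := hvw.
have cardGL : #|G| = #|L| := esym (same_deck_card eq_deck).
set H := ~: [set v; w] in H_neq0 H_uniq.
have copiesG : copies (induced H) G = [set H].
  apply/setP=> S; rewrite [RHS]inE; apply/copiesP/eqP=> [/H_uniq //|->].
  exact: isomorphic_refl.
have cardG : #|G| = #|H|.+2 by rewrite -(cardsC [set v; w]) cards2 neq.
have /eqP/cards1P[H' copiesL] : #|copies (induced H) L| = 1.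
  rewrite (same_deck_copies eq_deck) ?copiesG ?cards1 //.
  by rewrite card_induced cardG ltnW.
have H'_copy S : S \in copies (induced H) L -> S = H'.
  by rewrite copiesL inE => /eqP.
have cardH' : #|H'| = #|H|.
  by rewrite (@card_copy (induced H) L) ?card_induced // copiesL inE.
have card_pair : #|~: H'| = 2.
  by apply/eqP; rewrite -(eqn_add2l #|H'|) cardsC -cardGL cardG cardH' addn2.
(* A card of L isomorphic to G - x, for x in {v, w}, contains a copy of H,
   which can only be H'; hence the vertex deleted from L lies off H'. *)
have card_emb (x : G) (y : L) :
    x \in [set v; w] ->
    isomorphic (induced (~: [set y])) (induced (~: [set x])) ->
  [/\ y \in ~: H' & exists f : G -> L,
   [/\ embedding_on f (~: [set x]), f @: (~: [set x]) = ~: [set y] & f @: H = H']].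
  move=> Hx /isomorphic_sym/(isomorphic_induced_embedding y)[f f_emb fx].
  have sHx : H \subset ~: [set x] by rewrite setCS sub1set.
  have fH : f @: H = H'.
    apply: H'_copy; rewrite (imset_copy _ (embedding_onS sHx f_emb)).
    by rewrite copiesG inE.
  split; last by exists f.
  by have := imsetS f sHx; rewrite fH fx subsetC sub1set.
have [v' [w' [neq' iso_v iso_w]]] := same_deck_two_cards neq eq_deck.
have [H'v' [f [f_emb fv fH]]] := card_emb v v' (set21 v w) iso_v.
have [H'w' [g [g_emb gw gH]]] := card_emb w w' (set22 v w) iso_w.
have defH' : H' = ~: [set v'; w'].
  apply: setC_inj; rewrite setCK; apply/esym/eqP.
  by rewrite eqEcard card_pair cards2 neq' subUset !sub1set H'v' H'w'.
rewrite defH' in fH gH.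
have adj_vw : adj v' w' = adj v w.
  apply: same_deck_adj neq neq' _ eq_deck iso_v iso_w _.
    by rewrite cardG !ltnS card_gt0.
  rewrite -fH; apply/isomorphic_sym/isomorphic_imset/(embedding_onS _ f_emb).
  by rewrite setCS subsetUl.
case: hfixed => [v_fixed|w_fixed].
  exact: (isomorphic_glue neq neq' cardGL adj_vw f_emb fv g_emb gw fH gH v_fixed).
rewrite /H !(setUC [set v]) (setUC [set v']) in fH gH w_fixed.
apply: (isomorphic_glue (v := w) (w := v) _ _ _ _ g_emb gw f_emb fv gH fH w_fixed);
  by rewrite // 1?eq_sym // adj_sym adj_vw adj_sym.
Qed.
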